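(* Let $G$ be an acyclic ADT network over $\mathbb F_q$ with a single connection $c=(S,T,\mathcal X(S,T))$ of rate $R(c)=|\mathcal X(S,T)|$. The following are equivalent: (1) the connection $c$ is feasible; (2) $\mathrm{mincut}(S,T)\ge R(c)$; (3) there is an assignment of the coefficients $\alpha$, $\beta$, $\epsilon$ such that the $R(c)\times R(c)$ system matrix $M$ from $\mathcal X(S,T)$ to $\mathcal Z(T)$ is invertible over $\mathbb F_q$, i.e. $\det M\neq 0$.
   Context: ADT network model. $G=(\mathcal V,\mathcal E)$ is a directed acyclic network of supernodes. Each supernode $V$ has input ports $I(V)$ and output ports $O(V)$, and edges go from output ports to input ports of other supernodes. Linear coding over $\mathbb F_q$: - An output port $e\in O(V)$ carries $Y(e)=\sum_{e'\in I(V)}\beta_{(e',e)}Y(e')$. At the source $S$, the term $\sum_i\alpha_{(i,e)}X(S,i)$ is added, where the $X(S,i)$ are independent source processes. - An output port sends the same symbol on all of its outgoing edges. - An input port $e'$ receives $Y(e')=\sum_{(e,e')\in\mathcal E}Y(e)$, the sum taken over $\mathbb F_q$. - The destination $T$ outputs $Z(T,k)=\sum_{e'\in I(T)}\epsilon_{(e',(T,k))}Y(e')$. The coefficients $\alpha,\beta,\epsilon\in\mathbb F_q$ are free. A connection $(S,T,\mathcal X(S,T))$, with $\mathcal X(S,T)$ a set of source processes, is feasible if some coefficient choice makes $T$'s outputs $\mathcal Z(T)$ equal to $\mathcal X(S,T)$. The system matrix is $M=A(I-F)^{-1}B^T$ and satisfies $\mathcal Z(T)=\mathcal X(S,T)M$.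 Here ports are indexed $e_1,\dots,e_m$, and: - $F_{i,j}=1$ if $(e_i,e_j)\in\mathcal E$; $F_{i,j}=\beta_{(e_i,e_j)}$ if $e_i$ is an input port and $e_j$ an output port of the same supernode; $F_{i,j}=0$ otherwise. - $A_{i,j}=\alpha_{(i,e_j)}$ for $e_j\in O(S)$, and $0$ otherwise. - $B_{k,i}=\epsilon_{(e_i,(T,k))}$ for $e_i\in I(T)$, and $0$ otherwise. $\mathrm{mincut}(S,T)=\min_\Omega \mathrm{rank}(G_\Omega)$. The minimum ranges over partitions $\Omega\cup\Omega^c$ of the supernodes with $S\in\Omega$ and $T\in\Omega^c$. $G_\Omega$ is the $0$-$1$ incidence matrix of the edges from output ports of supernodes in $\Omega$ to input ports of supernodes in $\Omega^c$. *)

(* Defs.v *)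
From HB Require Import structures.
From mathcomp Require Import all_boot all_order all_algebra.
Set Implicit Arguments. Unset Strict Implicit. Unset Printing Implicit Defensive.
Import GRing.Theory.
Local Open Scope ring_scope.

(* An ADT network: supernodes V (a finite type); ports e_1..e_m are the
   ordinals 'I_m; [own e] is the supernode owning port e, [isin e] is true
   iff e is an input port (otherwise an output port); [E e e'] means there
   is an edge from port e to port e'. *)
Section ADT.
Variable F : fieldType.
Variables (V : finType) (m : nat) (own : 'I_m -> V) (isin : 'I_m -> bool)
          (E : rel 'I_m).

Definition adt_wf : Prop :=
  forall e e', E e e' -> [&& ~~ isin e, isin e' & own e != own e'].

Definition snode_rel : rel V :=
  fun v w => [exists e, exists e', [&& E e e', own e == v & own e' == w]].

Definition adt_acyclic : Prop :=
  forall v w, snode_rel v w -> ~~ connect snode_rel w v.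

Variables (S T : V) (r : nat).

(* Coefficients: al i e = alpha_(i,e), be e' e = beta_(e',e),
   ep k e' = epsilon_(e',(T,k)); only the entries allowed by the model
   are used. *)

(* Semantics: Y e is the coefficient row vector of Y(e) as an F-linear
   combination of the source processes X(S,0..r-1). *)
Definition signal_eqs (al : 'M[F]_(r, m)) (be : 'M[F]_m)
    (Y : 'I_m -> 'rV[F]_r) : Prop :=
  forall e, Y e =
    if isin e then \sum_(e0 | E e0 e) Y e0
    else \sum_(e' | isin e' && (own e' == own e)) be e' e *: Y e'
         + (if own e == S then \row_i al i e else 0).

Definition dest_output (ep : 'M[F]_(r, m)) (Y : 'I_m -> 'rV[F]_r)
    (k : 'I_r) : 'rV[F]_r :=
  \sum_(e | isin e && (own e == T)) ep k e *: Y e.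

Definition feasible : Prop :=
  exists al be ep Y, signal_eqs al be Y /\
    forall k : 'I_r, dest_output ep Y k = delta_mx ord0 k.

Definition Amx (al : 'M[F]_(r, m)) : 'M[F]_(r, m) :=
  \matrix_(i, j) if (own j == S) && ~~ isin j then al i j else 0.

Definition Fmx (be : 'M[F]_m) : 'M[F]_m :=
  \matrix_(i, j) if E i j then 1
                 else if [&& isin i, ~~ isin j & own i == own j]
                      then be i j else 0.

Definition Bmx (ep : 'M[F]_(r, m)) : 'M[F]_(r, m) :=
  \matrix_(k, i) if (own i == T) && isin i then ep k i else 0.

Definition sysM al be ep : 'M[F]_r :=
  Amx al *m invmx (1%:M - Fmx be) *m (Bmx ep)^T.

(* G_Omega: 0-1 incidence matrix of the edges from output ports of Omega
   to input ports of Omega^c (rows/columns indexed by all ports; zero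
   rows/columns do not change the rank). *)
Definition Gcut (Om : {set V}) : 'M[F]_m :=
  \matrix_(i, j) ([&& E i j, ~~ isin i, isin j,
                     own i \in Om & own j \notin Om] %:R).

Definition mincut : nat :=
  \big[minn/m]_(Om : {set V} | (S \in Om) && (T \notin Om)) \rank (Gcut Om).

End ADT.

(* Main.v *)
Require Import Defs.
From HB Require Import structures.
From mathcomp Require Import all_boot all_order all_algebra all_field zify.
Import GRing.Theory.
Local Open Scope ring_scope.

(** If the connection is feasible, then along the acyclic order every signal
    outside a cut is a combination of the at most [rank G_Omega] signals
    crossing it, whence [r <= rank G_Omega].  Conversely, eliminating the output
    ports turns invertibility of [M] into full row rank of
      [[1 - beta E, B^T], [alpha E, 0]],
    where [E] is the edge matrix.  Each coefficient occurs in a single row of this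
    matrix, so its rows can be chosen independently of each other, and Rado's
    theorem provides linearly independent rows as soon as every set of rows
    [A] has candidates spanning dimension at least [#|A|]; this reduces to the
    cut condition for the supernodes that own the input ports in [A].  As Rado's
    theorem holds over every field, no lower bound on [q] is needed. *)

(** * Rado's theorem on independent transversals of lists of vectors *)

Section Rado.
Variables (F : fieldType) (n : nat).

Definition seqmx (s : seq 'rV[F]_n) : 'M[F]_(size s, n) :=
  \matrix_(i < size s) s`_i.

Lemma seqmx_subP p (s : seq 'rV[F]_n) (B : 'M[F]_(p, n)) :
  reflect {in s, forall x, (x <= B)%MS} (seqmx s <= B)%MS.
Proof.
apply: (iffP row_subP) => [sB x /(nthP 0)[i lti <-] | sB i].
  by have := sB (Ordinal lti); rewrite rowK.
by rewrite rowK; apply/sB/mem_nth.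
Qed.

Variable I : finType.
Implicit Types (X : I -> seq 'rV[F]_n) (A : {set I}).

Definition spanmx X A : 'M[F]_n := (\sum_(i in A) <<seqmx (X i)>>)%MS.

Lemma spanmx_subP p X A (B : 'M[F]_(p, n)) :
  reflect {in A, forall i, {in X i, forall x, (x <= B)%MS}}
          (spanmx X A <= B)%MS.
Proof.
apply: (iffP sumsmx_subP) => sB i iA.
  by apply/seqmx_subP; move: (sB i iA); rewrite genmxE.
by rewrite genmxE; apply/seqmx_subP/sB.
Qed.

Lemma mem_spanmx {X A} i x : i \in A -> x \in X i -> (x <= spanmx X A)%MS.
Proof. by move=> iA; apply: (spanmx_subP _ _ _ _ (submx_refl _)). Qed.

(* If two members [x], [y] of the same [X i] were both indispensable,
   violating sets [A1], [A2] for the two deletions would contradict Hall's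
   condition for [A1 :|: A2] and [(A1 :&: A2) :\ i], by modularity of rank. *)
Lemma rado_delete X i x y s :
  X i = [:: x, y & s] -> (forall A, #|A| <= \rank (spanmx X A))%N ->
  let del z j := if j == i then z :: s else X j in
  (forall A, #|A| <= \rank (spanmx (del x) A))%N
    \/ (forall A, #|A| <= \rank (spanmx (del y) A))%N.
Proof.
move=> Xi hall del.
have delN z j : j != i -> del z j = X j by rewrite /del => /negPf->.
have deli z : del z i = z :: s by rewrite /del eqxx.
have bad z A : (\rank (spanmx (del z) A) < #|A|)%N -> i \in A.
  apply: contraLR => iA; rewrite -leqNgt; apply: leq_trans (hall A) _.
  apply/mxrankS/spanmx_subP => j jA t tX; apply: (mem_spanmx _ _ jA).
  by rewrite delN //; apply: contraNneq iA => <-.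
have [/forallP|/forallPn[A1]] :=
  boolP [forall A : {set I}, #|A| <= \rank (spanmx (del x) A)]%N; first by left.
have [/forallP|/forallPn[A2]] :=
  boolP [forall A : {set I}, #|A| <= \rank (spanmx (del y) A)]%N; first by right.
rewrite -!ltnNge => lt2 lt1; have iA1 := bad _ _ lt1; have iA2 := bad _ _ lt2.
set W1 := spanmx _ A1 in lt1; set W2 := spanmx _ A2 in lt2.
have cup : (spanmx X (A1 :|: A2) <= W1 + W2)%MS.
  apply/spanmx_subP => j jA t tX.
  have [ji|ji] := eqVneq j i.
    move: tX; rewrite ji Xi !inE => /or3P[/eqP->|/eqP->|ts].
    - apply: submx_trans (addsmxSl _ _); apply: (mem_spanmx _ _ iA1).
      by rewrite deli mem_head.
    - apply: submx_trans (addsmxSr _ _); apply: (mem_spanmx _ _ iA2).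
      by rewrite deli mem_head.
    - apply: submx_trans (addsmxSl _ _); apply: (mem_spanmx _ _ iA1).
      by rewrite deli inE ts orbT.
  have [jA1|jA2] := setUP jA.
    apply: submx_trans (addsmxSl _ _); apply: (mem_spanmx _ _ jA1).
    by rewrite delN.
  apply: submx_trans (addsmxSr _ _); apply: (mem_spanmx _ _ jA2).
  by rewrite delN.
have cap : (spanmx X ((A1 :&: A2) :\ i) <= W1 :&: W2)%MS.
  apply/spanmx_subP => j /setD1P[ji /setIP[jA1 jA2]] t tX.
  rewrite sub_capmx (mem_spanmx _ _ jA1) ?(mem_spanmx _ _ jA2) ?delN //.
(* By [cup] and [cap], [#|A1 :|: A2| + #|A1 :&: A2| - 1 <= \rank W1 + \rank W2 <= #|A1| + #|A2| -
   2], which is absurd. *)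
have := mxrank_sum_cap W1 W2.
have := leq_trans (hall _) (mxrankS cup); have := leq_trans (hall _) (mxrankS cap).
have := cardsUI A1 A2; have := cardsD1 i (A1 :&: A2); rewrite inE iA1 iA2 /=.
lia.
Qed.

(** Induction on the total number of candidates: [rado_delete] shortens a list with at least two
    entries; once all lists are singletons, Hall's condition for the full index set is
    independence. *)
Lemma rado X :
  (forall A, #|A| <= \rank (spanmx X A))%N ->
  exists f : I -> 'rV[F]_n,
    (forall i, f i \in X i) /\ (#|I| <= \rank (\sum_i <<f i>>)%MS)%N.
Proof.
have [N] := ubnP (\sum_i size (X i)); elim: N X => // N IHN X ltN hall.
have [i|small] := pickP (fun i => 1 < size (X i))%N.
  case Xi: (X i) => [|x [|y s]] // _.
  pose del z j := if j == i then z :: s else X j.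
  have ltdel z : (\sum_j size (del z j) < N)%N.
    rewrite -ltnS; apply: leq_trans ltN; rewrite ltnS.
    rewrite (bigD1 i) //= [ltnRHS](bigD1 i) //= Xi /del eqxx /= !addSn !ltnS.
    rewrite leq_add2l.
    by apply/leq_sum => j /negPf->.
  have IH z : z \in [:: x; y] -> (forall A, #|A| <= \rank (spanmx (del z) A))%N ->
      exists f : I -> 'rV[F]_n,
        (forall i, f i \in X i) /\ (#|I| <= \rank (\sum_i <<f i>>)%MS)%N.
    move=> zxy /(IHN _ (ltdel z))[f [fX rkf]]; exists f; split=> // j.
    have := fX j; rewrite /del; case: eqVneq => // ->.
    rewrite Xi !inE => /predU1P[->|->]; last by rewrite !orbT.
    by move: zxy; rewrite !inE => /orP[]->; rewrite ?orbT.
  case: (rado_delete _ _ _ _ _ Xi hall); [apply: (IH x) | apply: (IH y)];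
    by rewrite !inE eqxx ?orbT.
(* Hall's condition for [[set i]] excludes an empty list, so the default [0] of [head] never
   occurs. *)
have X1 i : X i = [:: head 0 (X i)].
  have := small i; have := hall [set i]; rewrite cards1 => /[swap].
  case Xi: (X i) => [|x []] // _; rewrite lt0n mxrank_eq0 -submx0 => /negP[].
  by apply/spanmx_subP => j /set1P->; rewrite Xi.
exists (fun i => head 0 (X i)); split=> [i|]; first by rewrite {2}X1 mem_head.
rewrite -cardsT; apply: leq_trans (hall _) (mxrankS _).
apply/spanmx_subP => i _ x; rewrite X1 inE => /eqP->.
by apply: (sumsmx_sup i) => //; rewrite genmxE.
Qed.
End Rado.

(** * Tools from linear algebra *)

Section MatrixLemmas.
Variable F : fieldType.

(** With [P] the input or the output ports, this kills products such as [edge_mx *m edge_mx],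
    because edges and coding alternate between the two kinds of port. *)
Lemma mulmx_disjoint m n p (P : pred 'I_n) (A : 'M[F]_(m, n)) (B : 'M_(n, p)) :
  (forall i j, ~~ P j -> A i j = 0) -> (forall j k, P j -> B j k = 0) ->
  A *m B = 0.
Proof.
move=> A0 B0; apply/matrixP => i k; rewrite !mxE big1 // => j _.
by have [/B0->|/A0->] := boolP (P j); rewrite (mulr0, mul0r).
Qed.

(** A left kernel vector satisfies [v = v *m A], so each coordinate is a combination of coordinates
    of smaller [h]; induction on [h] makes all of them vanish. *)
Lemma unitmx_sub_strict m (A : 'M[F]_m) (h : 'I_m -> nat) :
  (forall i j, A i j != 0 -> (h i < h j)%N) -> 1%:M - A \in unitmx.
Proof.
move=> hA; rewrite -row_free_unit; apply: inj_row_free => v.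
rewrite mulmxBr mulmx1 => /eqP; rewrite subr_eq0 => /eqP vA.
suff v0 N j : (h j < N)%N -> v 0 j = 0.
  by apply/rowP => j; rewrite mxE (v0 (h j).+1).
elim: N j => // N IHN j; rewrite ltnS => lejN; rewrite vA mxE big1 // => i _.
have [->|/hA ltij] := eqVneq (A i j) 0; first by rewrite mulr0.
by rewrite IHN ?mul0r // (leq_trans ltij).
Qed.

(** Rank-nullity for [B] on the row space of [W], whose kernel contains [U]. *)
Lemma mxrank_mul_kerS p q n k
    (W : 'M[F]_(p, n)) (U : 'M_(q, n)) (B : 'M_(n, k)) :
  (U <= W)%MS -> U *m B = 0 -> (\rank (W *m B) + \rank U <= \rank W)%N.
Proof.
move=> UW UB; rewrite -(mxrank_mul_ker W B) leq_add2l; apply: mxrankS.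
by rewrite sub_capmx UW; apply/sub_kermxP.
Qed.

Lemma mxrank_enum_delta n (P : {set 'I_n}) :
  \rank (\matrix_(i < #|P|) (delta_mx 0 (enum_val i) : 'rV[F]_n)) = #|P|.
Proof.
apply/eqP/row_freeP; exists (\matrix_(i < #|P|) delta_mx 0 (enum_val i))^T.
apply/matrixP => i j; rewrite !mxE (bigD1 (enum_val i)) //= !mxE !eqxx /=.
rewrite mul1r big1 => [|l /negPf ne]; last by rewrite !mxE ne mul0r.
by rewrite addr0 (inj_eq enum_val_inj).
Qed.

End MatrixLemmas.

(** * Algebra of the system matrix *)

Section Network.
Variables (F : fieldType) (V : finType) (m : nat) (own : 'I_m -> V)
  (isin : 'I_m -> bool) (E : rel 'I_m) (S T : V) (r : nat).
Hypothesis wfE : adt_wf own isin E.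

Local Notation sysF := (@Fmx F V m own isin E).
Local Notation sysA := (@Amx F V m own isin S r).
Local Notation sysB := (@Bmx F V m own isin T r).

Definition edge_mx : 'M[F]_m := \matrix_(i, j) (E i j)%:R.

Definition node_mx (be : 'M[F]_m) : 'M[F]_m :=
  \matrix_(i, j) if [&& isin i, ~~ isin j & own i == own j]
                 then be i j else 0.

Lemma node_mx0 : node_mx 0 = 0.
Proof. by apply/matrixP => i j; rewrite !mxE if_same. Qed.

Lemma FmxE be : sysF be = edge_mx + node_mx be.
Proof.
apply/matrixP => i j; rewrite !mxE; case: ifP => [/wfE/and3P[/negPf-> _ _]|_].
  by rewrite addr0.
by rewrite add0r.
Qed.

Lemma edge_mx_sq : edge_mx *m edge_mx = 0.
Proof.
apply: (mulmx_disjoint _ _ _ _ isin) => i j Pj; rewrite mxE;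
  by case Eij: (E i j) => //; case/and3P: (wfE _ _ Eij);
    rewrite ?Pj // (negPf Pj).
Qed.

Lemma node_mx_sq be : node_mx be *m node_mx be = 0.
Proof.
by apply: (mulmx_disjoint _ _ _ _ (predC isin)) => i j /= Pj; rewrite mxE;
  [move/negPn: Pj => ->; rewrite /= andbF | rewrite (negPf Pj)].
Qed.

Lemma Amx_node al be : sysA al *m node_mx be = 0.
Proof.
by apply: (mulmx_disjoint _ _ _ _ (predC isin)) => i j /= Pj; rewrite mxE;
  [move/negPn: Pj => ->; rewrite andbF | rewrite (negPf Pj)].
Qed.

Lemma node_mx_Bmx be ep : node_mx be *m (sysB ep)^T = 0.
Proof.
by apply: (mulmx_disjoint _ _ _ _ (predC isin)) => i j /= Pj; rewrite !mxE;
  [move/negPn: Pj => ->; rewrite /= andbF | rewrite (negPf Pj) andbF].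
Qed.

Lemma Amx_Bmx al ep : sysA al *m (sysB ep)^T = 0.
Proof.
by apply: (mulmx_disjoint _ _ _ _ (predC isin)) => i j /= Pj; rewrite !mxE;
  [move/negPn: Pj => ->; rewrite andbF | rewrite (negPf Pj) andbF].
Qed.

Lemma leq_mincutP k : S != T ->
  reflect (forall Om : {set V}, S \in Om -> T \notin Om ->
             k <= \rank (@Gcut F V m own isin E Om))%N
          (k <= @mincut F V m own isin E S T)%N.
Proof.
move=> neST; apply: (iffP idP) => [kmin Om SOm TOm | kcut].
  apply: leq_trans kmin _; rewrite /mincut; move: (mem_index_enum Om).
  elim: (index_enum _) => // O s IHs; rewrite inE big_cons.
  case/predU1P=> [<-|/IHs le_s]; first by rewrite SOm TOm geq_minl.
  by case: ifP => // _; apply: leq_trans (geq_minr _ _) le_s.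
rewrite /mincut; elim/big_ind: _ => [|x y kx ky|Om /andP[]]; last exact: kcut.
  (* The initial value [m] of the minimum must be bounded too: [[set S]] is a cut because [S != T],
     and its matrix has only [m] rows. *)
  apply: leq_trans (kcut [set S] _ _) (rank_leq_row _); rewrite inE //.
  by rewrite eq_sym.
by rewrite leq_min kx ky.
Qed.

(** * Necessity of the cut condition, and feasibility from an invertible system matrix *)

Section Acyclic.
Hypothesis acE : adt_acyclic own E.

Definition depth (v : V) : nat :=
  #|[pred u | connect (snode_rel own E) u v]|.

(** Every ancestor of [own e] is one of [own e'], and [own e'] itself is a new one by acyclicity. *)
Lemma edge_depth e e' : E e e' -> (depth (own e) < depth (own e'))%N.
Proof.
move=> Eee'; have vw : snode_rel own E (own e) (own e').
  by apply/existsP; exists e; apply/existsP; exists e'; rewrite Eee' !eqxx.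
apply/proper_card/properP; split; last first.
  by exists (own e'); rewrite !inE ?connect0 // acE.
by apply/subsetP => u; rewrite !inE => /connect_trans-> //; apply: connect1.
Qed.

(** Doubling leaves a level for the output ports of a supernode, above its input ports and below
    every supernode it feeds. *)
Definition port_depth (e : 'I_m) : nat := (depth (own e)).*2 + ~~ isin e.

Lemma port_depth_edge e e' : E e e' -> (port_depth e < port_depth e')%N.
Proof.
move=> Eee'; rewrite /port_depth; have := edge_depth _ _ Eee'.
by case/and3P: (wfE _ _ Eee') => -> -> _; lia.
Qed.

Lemma port_depth_node e e' :
  isin e -> ~~ isin e' -> own e == own e' -> (port_depth e < port_depth e')%N.
Proof. by rewrite /port_depth => -> -> /eqP->; lia. Qed.

Lemma unit_Fmx be : 1%:M - sysF be \in unitmx.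
Proof.
apply: (unitmx_sub_strict _ _ _ port_depth) => i j; rewrite mxE.
case: ifP => [/port_depth_edge //|_]; case: ifP => [/and3P[ini outj eqo] _|].
  exact: port_depth_node.
by rewrite eqxx.
Qed.

Lemma feasible_mincut : S != T -> @feasible F V m own isin E S T r ->
  (r <= @mincut F V m own isin E S T)%N.
Proof.
move=> neST [al [be [ep [Y [sigY outY]]]]]; apply/leq_mincutP => // Om SOm TOm.
(* For an input port [e] outside [Om], row [e] of [W] is what [e] receives from inside [Om]. *)
pose W := (@Gcut F V m own isin E Om)^T *m \matrix_e Y e.
have rowW e : own e \notin Om -> isin e ->
    row e W = \sum_(e0 | E e0 e && (own e0 \in Om)) Y e0.
  move=> eOm ine; rewrite row_mul mulmx_sum_row [RHS]big_mkcond /=.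
  apply: eq_bigr => e0 _; rewrite rowK !mxE ine eOm andbT /=.
  case Ee: (E e0 e); last by rewrite scale0r.
  case/and3P: (wfE _ _ Ee) => -> _ _ /=.
  by case: ifP; rewrite ?scale1r ?scale0r.
(* Induction in port order; no source term occurs outside [Om], since [S \in Om]. *)
have YW N e : (port_depth e < N)%N -> own e \notin Om -> (Y e <= W)%MS.
  elim: N e => // N IHN e; rewrite ltnS => leN eOm; rewrite sigY.
  case: ifP => ine.
    rewrite (bigID (fun e0 => own e0 \in Om)) /= -rowW // addmx_sub ?row_sub //.
    apply: summx_sub => e0 /andP[/port_depth_edge lte e0Om].
    by rewrite IHN // (leq_trans lte).
  case: eqP => [eS|_]; first by rewrite eS SOm in eOm.
  rewrite addr0; apply: summx_sub => e' /andP[ine' eqo].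
  apply/scalemx_sub/IHN; last by rewrite (eqP eqo).
  by apply: leq_trans leN; apply: port_depth_node; rewrite ?ine.
have : (1%:M <= W)%MS.
  apply/row_subP => k; rewrite row1 -outY; apply: summx_sub => e /andP[_ /eqP eT].
  by apply/scalemx_sub/(YW _ _ (ltnSn _)); rewrite eT.
move/mxrankS; rewrite mxrank1 => /leq_trans; apply.
by rewrite -[leqRHS]mxrank_tr mxrankM_maxl.
Qed.

Lemma det_feasible al be ep :
  \det (@sysM F V m own isin E S T r al be ep) != 0 ->
  @feasible F V m own isin E S T r.
Proof.
rewrite -unitfE -unitmxE => uM.
pose H := sysA al *m invmx (1%:M - sysF be).
(* These are the signal equations, with the signal at [e] as column [e] of [H]. *)
have HE : H = H *m sysF be + sysA al.
  apply/eqP; rewrite addrC -subr_eq -[X in X - _]mulmx1 -mulmxBr.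
  by rewrite mulmxKV ?unit_Fmx.
have uBH : sysB ep *m H^T \in unitmx by rewrite -unitmx_tr trmx_mul trmxK.
(* [sysB ep *m H^T] is the transposed system matrix; its inverse [N], absorbed into the destination
   coefficients, turns the outputs into the sources themselves. *)
move: H HE uBH {uM} => H HE uBH; pose N := invmx (sysB ep *m H^T).
exists al, be, (N *m ep), (fun e => row e H^T); split=> [e|k].
  apply/rowP => i; rewrite [LHS]mxE [LHS]mxE {1}HE [LHS]mxE [X in X + _]mxE.
  rewrite [X in _ + X]mxE.
  case ine: (isin e) => /=.
    rewrite andbF addr0 summxE [RHS]big_mkcond /=; apply: eq_bigr => j _.
    rewrite !mxE ine andbF; case: (E j e); first by rewrite mulr1.
    by rewrite mulr0.
  rewrite mxE summxE [X in _ = X + _]big_mkcond /=; congr (_ + _).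
    apply: eq_bigr => j _; rewrite !mxE ine /=.
    case: ifP => [/wfE/and3P[_]|_]; first by rewrite ine.
    by case: ifP; rewrite ?mulr0 // mulrC.
  by rewrite andbT; case: ifP; rewrite !mxE.
rewrite -row1 -(mulVmx uBH) mulmxA row_mul mulmx_sum_row /dest_output.
rewrite big_mkcond; apply: eq_bigr => e _; rewrite !mxE andbC.
rewrite /=; case: ifP => Te; last first.
  by rewrite big1 ?scale0r // => j _; rewrite mxE Te mulr0.
by congr (_ *: _); apply: eq_bigr => j _; rewrite mxE Te.
Qed.

End Acyclic.

(** * Elimination of the output ports *)

Definition port_row (b : 'M[F]_m) (c : 'M[F]_(r, m)) (e : 'I_m) :
    'rV[F]_(m + r) :=
  row e (row_mx (1%:M - node_mx b *m edge_mx) (sysB c)^T).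

Definition source_row (a : 'M[F]_(r, m)) (k : 'I_r) : 'rV[F]_(m + r) :=
  row k (row_mx (sysA a *m edge_mx) 0).

(* A left kernel vector [u] of [M] yields the left kernel vector [(w E, - u)] of
   the block matrix, where [w = u A (1 - F)^-1]. *)
Lemma row_free_sysM al be ep :
  1%:M - sysF be \in unitmx ->
  row_free (col_mx (row_mx (1%:M - node_mx be *m edge_mx) (sysB ep)^T)
                   (row_mx (sysA al *m edge_mx) 0)) ->
  \det (@sysM F V m own isin E S T r al be ep) != 0.
Proof.
move=> uF free; rewrite -unitfE -unitmxE -row_free_unit; apply: inj_row_free => u.
rewrite /sysM !mulmxA; set w := u *m _ *m _ => wB.
have wE : w = w *m edge_mx + (w *m node_mx be + u *m sysA al).
  rewrite addrA -mulmxDr -FmxE; apply/eqP.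
  by rewrite addrC -subr_eq -[X in X - _]mulmx1 -mulmxBr mulmxKV.
(* [node_mx be] reads only input ports, where [w] coincides with [w *m edge_mx]. *)
have wN : w *m node_mx be = w *m edge_mx *m node_mx be.
  rewrite {1}wE !mulmxDl -!mulmxA node_mx_sq Amx_node !mulmx0 !addr0.
  by rewrite mulmxA.
have wEB : w *m edge_mx *m (sysB ep)^T = 0.
  rewrite -wB [in RHS]wE !mulmxDl -!mulmxA node_mx_Bmx Amx_Bmx !mulmx0.
  by rewrite !addr0.
have wEE : w *m edge_mx = (w *m node_mx be + u *m sysA al) *m edge_mx.
  by rewrite {1}wE mulmxDl -mulmxA edge_mx_sq mulmx0 add0r.
have /(row_free_inj free)/eq_row_mx[_ /eqP] :
    row_mx (w *m edge_mx) (- u) *m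
      col_mx (row_mx (1%:M - node_mx be *m edge_mx) (sysB ep)^T)
             (row_mx (sysA al *m edge_mx) 0)
    = row_mx 0 0 *m
      col_mx (row_mx (1%:M - node_mx be *m edge_mx) (sysB ep)^T)
             (row_mx (sysA al *m edge_mx) 0).
  rewrite row_mx0 mul0mx mul_row_col !mul_mx_row wEB mulmx0 add_row_mx addr0.
  rewrite mulmxBr mulmx1 !mulmxA -wN {1}wEE mulmxDl !mulNmx.
  by rewrite addrAC addrK subrr row_mx0.
by rewrite oppr_eq0 => /eqP.
Qed.

(* The affine space of admissible rows is spanned by the rows obtained from
   zero or unit coefficients, so these finitely many candidates suffice. *)
Definition row_choices (i : 'I_m + 'I_r) : seq 'rV[F]_(m + r) :=
  match i with
  | inl e => port_row 0 0 e ::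
      [seq port_row (delta_mx e o) 0 e | o <- enum 'I_m] ++
      [seq port_row 0 (delta_mx k e) e | k <- enum 'I_r]
  | inr k => [seq source_row (delta_mx k o) k | o <- enum 'I_m]
  end.

Lemma row_choices_coef (f : 'I_m + 'I_r -> 'rV[F]_(m + r)) :
  (forall i, f i \in row_choices i) ->
  exists al be ep, (forall e, f (inl e) = port_row be ep e)
    /\ (forall k, f (inr k) = source_row al k).
Proof.
move=> fX.
have /fin_all_exists[bc fE] e : exists bc, f (inl e) = port_row bc.1 bc.2 e.
  have := fX (inl e); rewrite inE mem_cat.
  case/or3P=> [/eqP->|/mapP[o _ ->]|/mapP[k _ ->]].
  - by exists (0, 0).
  - by exists (delta_mx e o, 0).
  - by exists (0, delta_mx k e).
have /fin_all_exists[a fS] k : exists a, f (inr k) = source_row a k.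
  by have /mapP[o _ ->] := fX (inr k); exists (delta_mx k o).
(* Each chosen row supplies its own coefficients: row [i] of [be] and column [i] of [ep] for a port,
   row [k] of [al] for a source. *)
exists (\matrix_(k, i) a k k i), (\matrix_(i, j) (bc i).1 i j),
  (\matrix_(k, i) (bc i).2 k i); split=> [e|k].
  rewrite fE /port_row !row_row_mx !raddfB /= !row_mul.
  by congr (row_mx (_ - _ *m _) _); apply/rowP => j; rewrite !mxE.
rewrite fS /source_row !row_row_mx !row_mul.
by congr (row_mx (_ *m _) _); apply/rowP => j; rewrite !mxE.
Qed.

Lemma port_row00 e : port_row 0 0 e = row_mx (delta_mx 0 e) 0.
Proof.
rewrite /port_row row_row_mx node_mx0 mul0mx subr0 row1; congr row_mx.
by apply/rowP => j; rewrite !mxE if_same.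
Qed.

(** * Hall's condition from the cut condition *)

Section HallCondition.
Variable A : {set 'I_m + 'I_r}.
Local Notation W := (spanmx F (m + r) _ row_choices A).

Lemma span_port e : inl e \in A -> ((row_mx (delta_mx 0 e) 0 : 'rV_(m + r)) <= W)%MS.
Proof.
by move=> eA; rewrite -port_row00 (mem_spanmx _ _ _ _ _ eA) //= mem_head.
Qed.

(** The candidates with zero and with unit coefficient differ exactly by this edge row, as their
    identity parts cancel. *)
Lemma span_node e o : inl e \in A -> isin e -> ~~ isin o -> own e = own o ->
  ((row_mx (row o edge_mx) 0 : 'rV_(m + r)) <= W)%MS.
Proof.
move=> eA ine outo eo.
have ->: row_mx (row o edge_mx) 0
    = row_mx (delta_mx 0 e) 0 - port_row (delta_mx e o) 0 e.
  rewrite -port_row00 /port_row !row_row_mx opp_row_mx add_row_mx subrr.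
  congr row_mx; rewrite !raddfB /= opprK node_mx0 mul0mx row0 subr0.
  rewrite addrA subrr add0r row_mul [LHS]rowE; congr (_ *m _); apply/rowP => j.
  rewrite !mxE !eqxx /= ine /=; case: (eqVneq j o) => [->|_].
    by rewrite outo eo eqxx.
  by rewrite if_same.
rewrite addmx_sub ?span_port // eqmx_opp (mem_spanmx _ _ _ _ _ eA) //=.
rewrite inE mem_cat; apply/or3P/Or32/mapP.
by exists o; rewrite ?mem_enum.
Qed.

Lemma span_dest e k : inl e \in A -> isin e -> own e = T ->
  ((row_mx 0 (delta_mx 0 k) : 'rV_(m + r)) <= W)%MS.
Proof.
move=> eA ine eT.
have ->: row_mx 0 (delta_mx 0 k)
    = port_row 0 (delta_mx k e) e - row_mx (delta_mx 0 e) 0.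
  rewrite -port_row00 /port_row !row_row_mx opp_row_mx add_row_mx subrr.
  congr row_mx; apply/rowP => j; rewrite !mxE eT ine !eqxx /= andbT.
  by rewrite subr0.
rewrite addmx_sub ?eqmx_opp ?span_port // (mem_spanmx _ _ _ _ _ eA) //=.
rewrite inE mem_cat; apply/or3P/Or33/mapP.
by exists k; rewrite ?mem_enum.
Qed.

Lemma span_source k o : inr k \in A -> own o = S -> ~~ isin o ->
  ((row_mx (row o edge_mx) 0 : 'rV_(m + r)) <= W)%MS.
Proof.
move=> kA oS outo.
have ->: row_mx (row o edge_mx) 0 = source_row (delta_mx k o) k.
  rewrite /source_row row_row_mx row0; congr row_mx.
  rewrite row_mul [LHS]rowE; congr (_ *m _); apply/rowP => j; rewrite !mxE eqxx.
  by case: eqVneq => [->|_]; rewrite ?oS ?eqxx ?outo ?if_same.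
rewrite (mem_spanmx _ _ _ _ _ kA) //=.
by apply/mapP; exists o; rewrite ?mem_enum.
Qed.

Lemma hall_row_choices : S != T ->
  (r <= @mincut F V m own isin E S T)%N -> (#|A| <= \rank W)%N.
Proof.
move=> neST /leq_mincutP-/(_ neST) cut.
pose P := [set e | inl e \in A]; pose Q := [set k | inr k \in A].
have cardA : #|A| = (#|P| + #|Q|)%N.
  rewrite -!sum1_card big_mkcond big_sumType -!big_mkcond /=.
  by congr (_ + _)%N; apply: eq_bigl => i; rewrite inE.
have leQ : (#|Q| <= r)%N by rewrite -[leqRHS]card_ord max_card.
pose D := \matrix_(i < #|P|) (delta_mx 0 (enum_val i) : 'rV[F]_m).
have DW : (row_mx D (0 : 'M_(_, r)) <= W)%MS.
  apply/row_subP => i; rewrite row_row_mx rowK row0 span_port //.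
  by have := enum_valP i; rewrite inE.
have rkD : \rank (row_mx D (0 : 'M_(_, r))) = #|P|.
  by rewrite rank_row_mx0 mxrank_enum_delta.
(* The unit rows of the ports in [P] already give [#|P|] dimensions; it remains to find a [B] that
   kills them and maps [W] to rank at least [#|Q|]. *)
have leW k (B : 'M_(_, k)) : row_mx D 0 *m B = 0 ->
    (#|Q| <= \rank (W *m B))%N -> (#|A| <= \rank W)%N.
  move=> DB leQB; rewrite cardA addnC -rkD.
  by apply: leq_trans (mxrank_mul_kerS _ _ _ _ _ _ _ _ DW DB); rewrite leq_add2r.
pose Z := [set v | [exists e in P, isin e && (own e == v)]].
have ZP e : isin e -> e \in P -> own e \in Z.
  by move=> ine eP; rewrite inE; apply/existsP; exists e; rewrite eP ine /=.
have [Q0|[k0 kQ]] := set_0Vmem Q.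
  by apply: (leW 0 0); rewrite ?mulmx0 // Q0 cards0.
(* If [T] owns an input port of [P], the decoding coefficients there span all of the last [r]
   coordinates. *)
have [TZ|TZ] := boolP (T \in Z).
  apply: (leW r (col_mx 0 1%:M)).
    by rewrite mul_row_col mulmx0 mul0mx addr0.
  apply: leq_trans leQ _; rewrite -[leqLHS](mxrank1 F); apply: mxrankS.
  rewrite [X in (X <= _)%MS](_ :
    1%:M = row_mx (0 : 'M_(r, m)) 1%:M *m col_mx 0 1%:M); last first.
    by rewrite mul_row_col mulmx0 mulmx1 add0r.
  apply: submxMr; apply/row_subP => k; rewrite row_row_mx row0 row1.
  move: TZ; rewrite inE => /exists_inP[e eP /andP[ine /eqP eT]].
  by apply: (span_dest e); rewrite // inE in eP *.
pose Om := S |: Z.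
have TOm : T \notin Om by rewrite in_setU1 negb_or eq_sym neST.
(* [K] keeps the input ports outside [Om]: it kills [D], as input ports of [P] are owned in [Z], and
   maps edge rows of output ports in [Om] to rows of [Gcut]. *)
pose K := diag_mx (\row_e (isin e && (own e \notin Om))%:R) : 'M[F]_m.
apply: (leW _ (col_mx K 0)).
  rewrite mul_row_col mul0mx addr0; apply/row_matrixP => i.
  rewrite row_mul rowK row0; apply/rowP => j; rewrite mul_mx_diag !mxE /=.
  case: eqP => [->|_]; last by rewrite mul0r.
  rewrite mul1r; case ine: (isin _) => //=.
  by rewrite /Om in_setU (ZP _ ine (enum_valP i)) orbT.
apply: leq_trans leQ _; apply: leq_trans (cut Om (setU11 _ _) TOm) _.
apply/mxrankS/row_subP => o.
have [/andP[outo oOm]|oN] := boolP (~~ isin o && (own o \in Om)); last first.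
  suff ->: row o (Gcut F own isin E Om) = 0 by rewrite sub0mx.
  apply/rowP => j; rewrite !mxE; case: (isin o) (own o \in Om) oN => [] [] //=;
    by rewrite ?andbF.
have ->: row o (Gcut F own isin E Om)
    = row_mx (row o edge_mx) (0 : 'rV_r) *m col_mx K 0.
  rewrite mul_row_col mulmx0 addr0; apply/rowP => j.
  by rewrite mul_mx_diag !mxE outo oOm -natrM mulnb.
apply: submxMr; move: oOm; rewrite in_setU1 => /predU1P[oS|].
  (* A nonempty [Q] provides the edge rows of [S]. *)
  by apply: (span_source k0) => //; rewrite inE in kQ.
rewrite inE => /exists_inP[e eP /andP[ine /eqP eo]].
by apply: (span_node e) => //; rewrite inE in eP.
Qed.

End HallCondition.

(** * Sufficiency of the cut condition, and the equivalences *)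

Lemma mincut_det : adt_acyclic own E -> S != T ->
  (r <= @mincut F V m own isin E S T)%N ->
  exists al be ep, \det (@sysM F V m own isin E S T r al be ep) != 0.
Proof.
move=> acE neST cut.
have [f [/row_choices_coef[al [be [ep [fE fS]]]] rkf]] :=
  rado _ _ _ _ (fun A => hall_row_choices A neST cut).
exists al, be, ep; apply: row_free_sysM; first exact: unit_Fmx.
(* The block matrix has exactly the [m + r] chosen rows, so their independence is its full row
   rank. *)
rewrite -row_leq_rank; rewrite card_sum !card_ord in rkf.
apply: leq_trans rkf (mxrankS _); apply/sumsmx_subP => -[e|k] _.
  rewrite genmxE fE (submx_trans (row_sub _ _)) //.
  by rewrite -addsmxE addsmxSl.
by rewrite genmxE fS (submx_trans (row_sub _ _)) // -addsmxE addsmxSr.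
Qed.

End Network.

Theorem theorem3 (F : finFieldType) (V : finType) (m : nat)
    (own : 'I_m -> V) (isin : 'I_m -> bool) (E : rel 'I_m)
    (S T : V) (r : nat) :
  adt_wf own isin E -> adt_acyclic own E -> S != T ->
  (@feasible F V m own isin E S T r <->
     (r <= @mincut F V m own isin E S T)%N) /\
  ((r <= @mincut F V m own isin E S T)%N <->
    exists (al : 'M[F]_(r, m)) (be : 'M[F]_m) (ep : 'M[F]_(r, m)),
      \det (@sysM F V m own isin E S T r al be ep) != 0).
Proof.
move=> wfE acE neST.
have det_feas : (exists al be ep,
    \det (@sysM F V m own isin E S T r al be ep) != 0) ->
    @feasible F V m own isin E S T r.
  by case=> al [be [ep]]; apply: det_feasible.
split; split.
- exact: feasible_mincut.
- by move=> cut; apply/det_feas/mincut_det.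
- exact: mincut_det.
- by move/det_feas; apply: feasible_mincut.
Qed.
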